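(* Let $(F,\rho,m)$ be a metric measure space with metric $\rho$ and Radon measure $m$ with full support. Let $\phi,V:[0,\infty)\to[0,\infty)$ be non-decreasing, positive on $(0,\infty)$, with $\phi(0)=V(0)=0$, $\phi$ left-continuous and $\lim_{x\to\infty}\phi(x)=\infty$, and suppose there are constants $c_1,c_2>0$ such that $c_1V(r)\le m(B(x,r))\le c_2V(r)$ for all $x\in F$, $r\ge0$, where $B(x,r)=\{y\in F:\rho(x,y)<r\}$. Let $p$ be a symmetric subprobability transition density on $F$ such that $$p_t(x,y)\approx\frac1{V(\phi^{-1}(t))}\wedge\frac t{V(\rho(x,y))\,\phi(\rho(x,y))},\qquad t>0,\ x,y\in F.$$ Let $\underline A>\overline\alpha>0$, $V\in\mathrm{WLSC}(\underline A,\underline C)$ and $\phi\in\mathrm{WUSC}(\overline\alpha,\overline c)$, and let $0<\beta<\underline A/\overline\alpha-1$. For $y\in F$ let $h_y(x)=\int_0^\infty t^\beta p_t(x,y)\,dt$ and $k_y(x)=\int_0^\infty\beta t^{\beta-1}p_t(x,y)\,dt$, and let $C_1>0$ be a constant such that $C_1\,\phi(\rho(x,y))^{-1}\le k_y(x)/h_y(x)$ for all $x,y\in F$ with $x\ne y$ (such a constant exists). Then there exists a constant $c$ such that for all $x,y\in F$ with $x\ne y$ and all $t>0$, $$\int_Fp_t(x,z)\,\frac{\phi(\rho(z,y))^{\beta+1}}{V(\rho(z,y))}\,m(dz)\le c\,\frac{\phi(\rho(x,y))^{\beta+1}}{V(\rho(x,y))}$$ and $$\int_F\tilde p_t(x,z)\,\frac{\phi(\rho(z,y))^{\beta+1}}{V(\rho(z,y))}\,m(dz)\le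 c\,\frac{\phi(\rho(x,y))^{\beta+1}}{V(\rho(x,y))},$$ where $\tilde p$ is the Schrödinger perturbation of $p$ by $q(x)=C_1\,\phi(\rho(x,y))^{-1}$.
   Context: Scaling conditions: for $\varphi:[0,\infty)\to[0,\infty)$, $\varphi\in\mathrm{WLSC}(\underline a,\underline k)$ (with $\underline a\in\mathbb R$, $\underline k\in(0,1]$) means $\varphi(\lambda\theta)\ge\underline k\,\lambda^{\underline a}\varphi(\theta)$ for all $\lambda\ge1$, $\theta>0$; $\varphi\in\mathrm{WUSC}(\overline a,\overline k)$ (with $\overline a\in\mathbb R$, $\overline k\in[1,\infty)$) means $\varphi(\lambda\theta)\le\overline k\,\lambda^{\overline a}\varphi(\theta)$ for all $\lambda\ge1$, $\theta>0$. $\phi^{-1}(u)=\inf\{s>0:\phi(s)>u\}$ for $u\ge0$. $a\wedge b=\min(a,b)$, and $t/0=\infty$ for $t>0$. $f\approx g$ means that there is a constant $c>0$ with $c^{-1}g\le f\le cg$ on the whole indicated domain. A symmetric subprobability transition density on $F$ is a jointly measurable function $p:(0,\infty)\times F\times F\to[0,\infty]$ with $p_t(x,y)=p_t(y,x)$, $\int_Fp_s(x,y)p_t(y,z)\,m(dy)=p_{s+t}(x,z)$ for all $x,z\in F$, $s,t>0$, and $\int_Fp_t(x,y)\,m(dy)\le1$; $m$ is $\sigma$-finite. For $q\ge0$, the Schrödinger perturbation of $p$ by $q$ is $\tilde p=\sum_{n=0}^\infty p^{(n)}$, where $p^{(0)}_t(x,z)=p_t(x,z)$ and $$p^{(n)}_t(x,z)=\int_0^t\int_Fp_s(x,w)\,q(w)\,p^{(n-1)}_{t-s}(w,z)\,m(dw)\,ds,\qquad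 n\ge1.$$ The value of $q$ and of the integrands at the single point $y$ is irrelevant, since $m(\{y\})=0$. *)

(* Defs.v *)
From HB Require Import structures.
From mathcomp Require Import all_boot all_order all_algebra.
From mathcomp Require Import all_classical all_reals all_analysis.
From mathcomp Require Import measurable_realfun.

Set Implicit Arguments.
Unset Strict Implicit.
Unset Printing Implicit Defensive.

Import Order.TTheory GRing.Theory Num.Theory.
Import numFieldNormedType.Exports.

Local Open Scope classical_set_scope.
Local Open Scope ring_scope.

(* A metric space that also carries a sigma-algebra. The class does not relate
   the two structures; [borel_sigma_algebra] does. Since [measurableType] inherits from
   [pointedType], the space is nonempty. *)
#[short(type="measurableMetricType")]
HB.structure Definition MeasurableMetric (d : measure_display)
    (K : numDomainType) :=
  { T of Measurable d T & Metric K T }.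

Section MetricMeasure.
Context {d : measure_display} {R : realType} {F : measurableMetricType d R}.
Local Open Scope ereal_scope.

Definition borel_sigma_algebra : Prop :=
  (@measurable d F : set (set F)) = <<s [set A : set F | open A] >>.

Definition radon (m : {measure set F -> \bar R}) : Prop :=
  (forall x : F, exists2 U : set F, open_nbhs x U & m U < +oo) /\
  (forall A : set F, measurable A ->
     m A = ereal_sup [set m K | K in [set K : set F | compact K /\ K `<=` A]]).

Definition full_support (m : {measure set F -> \bar R}) : Prop :=
  forall U : set F, open U -> U !=set0 -> 0 < m U.

End MetricMeasure.
Arguments borel_sigma_algebra {d R} F.

Section Scaling.
Context {R : realType}.
Implicit Types f phi V : R -> R.

(* A function [0, +oo) -> [0, +oo) is represented by a total function R -> R;
   every condition on it only looks at nonnegative arguments. *)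
Definition scale_function f : Prop :=
  [/\ {in `[0, +oo[ &, {homo f : x y / x <= y}},
      (forall x, 0 < x -> 0 < f x) & f 0 = 0].

Definition wlsc (a k : R) f : Prop :=
  0 < k <= 1 /\
  forall lambda theta, 1 <= lambda -> 0 < theta ->
    k * lambda `^ a * f theta <= f (lambda * theta).

Definition wusc (a k : R) f : Prop :=
  1 <= k /\
  forall lambda theta, 1 <= lambda -> 0 < theta ->
    f (lambda * theta) <= k * lambda `^ a * f theta.

Definition rinv phi (u : R) : R := inf [set s | 0 < s /\ u < phi s].

Definition left_continuous phi : Prop :=
  forall x, 0 < x -> phi y @[y --> x^'-] --> phi x.

End Scaling.

Section Kernels.
Context {d : measure_display} {R : realType} {F : measurableMetricType d R}.
Local Open Scope ereal_scope.
Implicit Types (m : {measure set F -> \bar R}) (p : R -> F -> F -> \bar R).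

(* A kernel p_t(x, y), t > 0, is a total function of t : R; its values at
   t <= 0 are unconstrained and never used. *)
Definition symmetric_subprob_density m p : Prop :=
  [/\ measurable_fun
        [set u : R * F * F | (0 < u.1.1)%R]
        (fun u : R * F * F => p u.1.1 u.1.2 u.2),
      forall t x y, (0 < t)%R -> 0 <= p t x y,
      forall t x y, (0 < t)%R -> p t x y = p t y x,
      forall s t x z, (0 < s)%R -> (0 < t)%R ->
        \int[m]_y (p s x y * p t y z) = p (s + t)%R x z &
      forall t x, (0 < t)%R -> \int[m]_y p t x y <= 1].

(* The inverse is that of [\bar R], with 0^-1 = +oo. *)
Definition kernel_profile (phi V : R -> R) (t : R) (x y : F) : \bar R :=
  Order.min ((V (rinv phi t))%:E^-1)
            (t%:E / (V (mdist x y) * phi (mdist x y))%:E).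

(* h_function beta p y x and k_function beta p y x are h_y(x) and k_y(x). *)
Definition h_function (beta : R) p (y x : F) : \bar R :=
  \int[lebesgue_measure]_(t in `]0%R, +oo[) ((t `^ beta)%:E * p t x y).

Definition k_function (beta : R) p (y x : F) : \bar R :=
  \int[lebesgue_measure]_(t in `]0%R, +oo[)
    ((beta * t `^ (beta - 1))%:E * p t x y).

Fixpoint perturbation_term m p (q : F -> \bar R) (n : nat) (t : R) (x z : F) :
    \bar R :=
  if n is n'.+1 then
    \int[lebesgue_measure]_(s in `]0%R, t[)
      \int[m]_w (p s x w * q w * perturbation_term m p q n' (t - s)%R w z)
  else p t x z.

Definition schrodinger_perturbation m p (q : F -> \bar R) (t : R) (x z : F) :
    \bar R :=
  \sum_(0 <= n <oo) perturbation_term m p q n t x z.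

End Kernels.

(* Main.v *)
Require Import Defs.
From HB Require Import structures.
From mathcomp Require Import all_boot all_order all_algebra.
From mathcomp Require Import all_classical all_reals all_analysis.
From mathcomp Require Import measurable_realfun.
From mathcomp Require Import ring lra.

(** Write [h_y] and [k_y] for the integrals of [t^beta] and [beta t^(beta-1)]
    against [p_t(., y)]. By Chapman-Kolmogorov and Tonelli,
    [P_t h_y + \int_0^t P_s k_y ds <= h_y]. The hypothesis on [C1] gives
    [q h_y <= k_y] off the null set [{y}], so Duhamel's recursion for the
    perturbation series turns this excess inequality, by induction, into
    [\sum_(i < n) P^(i)_t h_y <= h_y] for every [n]. Finally the two-sided bound
    on [p] and the scaling of [V] and [phi] make [h_y] comparable, off [y], with
    the weight [phi^(beta+1) / V] of the statement. *)

Set Implicit Arguments.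
Unset Strict Implicit.
Unset Printing Implicit Defensive.

Import Order.TTheory GRing.Theory Num.Theory.
Import numFieldNormedType.Exports.

Local Open Scope classical_set_scope.
Local Open Scope ring_scope.

(** The weight of the statement satisfies no useful inequality under the semigroup, whereas [h_y] is
    an integral of the kernel over time: Chapman-Kolmogorov turns [P_t] into a shift of the time
    weight, and the excess inequality reduces to one about functions of a single time [r], namely
    [(r - t)_+^beta + \int_0^t beta (r - s)_+^(beta - 1) ds <= r^beta]. The series is summed against
    [h_y], so the comparison with the weight costs a constant once and not at every order; the final
    constant therefore does not depend on [C1]. Inequalities stay additive, since [h_y(y)] may be
    infinite. The condition [beta < lA / upalpha - 1] is what makes the time integral in [h_y]
    converge at infinity. *)

Section Integration.
Local Open Scope ereal_scope.

Lemma integral_outside0 d (T : measurableType d) (R : realType)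
    (mu : {measure set T -> \bar R}) (D : set T) (f : T -> \bar R) :
  (forall x, ~ D x -> f x = 0) ->
  \int[mu]_(x in D) f x = \int[mu]_x f x.
Proof.
move=> f0; rewrite integral_mkcond; apply: eq_integral => x _.
by rewrite patchE; case: ifPn => // /negP xD; rewrite f0// => Dx; apply: xD; rewrite inE.
Qed.

(** * Tonelli's theorem for curried nonnegative functions *)

Section Tonelli.
Context d1 d2 (T1 : measurableType d1) (T2 : measurableType d2) (R : realType).
Variables (m1 : {sigma_finite_measure set T1 -> \bar R})
          (m2 : {sigma_finite_measure set T2 -> \bar R}).
Variable f : T1 -> T2 -> \bar R.
Hypothesis mf : measurable_fun setT (fun u : T1 * T2 => f u.1 u.2).
Hypothesis f_ge0 : forall x y, 0 <= f x y.

Lemma tonelli_exchange :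
  \int[m1]_x \int[m2]_y f x y = \int[m2]_y \int[m1]_x f x y.
Proof. by apply: (fubini_tonelli (fun u => f u.1 u.2)) => // -[]. Qed.

Lemma measurable_integral2 : measurable_fun setT (fun x => \int[m2]_y f x y).
Proof.
apply: (measurable_fun_fubini_tonelli_F (m2 := m2) (fun u => f u.1 u.2)) => //.
Qed.

End Tonelli.

(** * Translation invariance of Lebesgue integration *)

Section Shift.
Context {R : realType}.
Local Notation mu := (@lebesgue_measure R).

Let measurable_shift (c : R) :
  measurable_fun setT ((fun x => x + c)%R : measurableTypeR R -> measurableTypeR R).
Proof.
apply: (@measurable_funD _ (measurableTypeR R) R setT idfun (cst c)).
- exact: measurable_id.
- exact: measurable_cst.
Qed.

(** Lebesgue measure is determined by its values on the intervals []a, b]], and the preimage []a -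
    c, b - c]] of such an interval has the same length. *)
Lemma lebesgue_measure_shift (c : R) (A : set R) : measurable A ->
  pushforward mu ((fun x => x + c)%R : _ -> measurableTypeR R) A = mu A.
Proof.
move=> mA; apply/esym/lebesgue_measure_unique => //= _ [[a b]] _ <-.
rewrite /pushforward.
have -> : (fun x => x + c)%R @^-1` [set` `]a, b]] = [set` `]a - c, b - c]%R].
  by apply/seteqP; split => x /=; rewrite !in_itv/= ltrBlDr lerBrDr.
by rewrite !lebesgue_measure_itv/= !lte_fin ltrD2r -!EFinB opprB addrA subrK.
Qed.

Lemma ge0_integral_shift (c : R) (f : R -> \bar R) :
  measurable_fun [set: measurableTypeR R] f -> (forall x, 0 <= f x) ->
  \int[mu]_x f (x + c)%R = \int[mu]_x f x.
Proof.
move=> mf f0.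
have := @ge0_integral_pushforward _ _ _ _ R _ (measurable_shift c) mu setT f
  measurableT mf (fun x _ => f0 x).
rewrite preimage_setT => /= <-.
by apply: eq_measure_integral => //= A mA _; exact: lebesgue_measure_shift.
Qed.

End Shift.
End Integration.

(** * The perturbation series integrated against an excessive-type function *)

Section Perturbation.
Local Open Scope ereal_scope.
Context {d : measure_display} {R : realType} {F : measurableMetricType d R}.
Variable m : {sigma_finite_measure set F -> \bar R}.
Local Notation GR := (measurableTypeR R).
Local Notation mu := (@lebesgue_measure R).

(** Joint measurability in time and both points is assumed once; every section and substitution that
    Tonelli requires below is obtained from it by composition. *)
Lemma measurable_kernel_comp (K : R -> F -> F -> \bar R) d' (T : measurableType d')
    (a : T -> GR) (b c : T -> F) :
  measurable_fun setT (fun u : GR * F * F => K u.1.1 u.1.2 u.2) ->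
  measurable_fun setT a -> measurable_fun setT b -> measurable_fun setT c ->
  measurable_fun setT (fun v => K (a v) (b v) (c v)).
Proof.
move=> mK ma mb mc.
apply: (@measurableT_comp _ _ _ _ _ _ (fun u : GR * F * F => K u.1.1 u.1.2 u.2)
  _ (fun v => (a v, b v, c v))) => //.
by apply: measurable_fun_pair => //; exact: measurable_fun_pair.
Qed.

Variables (P : R -> F -> F -> \bar R) (q : F -> \bar R).
Hypothesis mP : measurable_fun setT (fun u : GR * F * F => P u.1.1 u.1.2 u.2).
Hypothesis P_ge0 : forall t x y, 0 <= P t x y.
Hypothesis P_npos : forall t x y, (t <= 0)%R -> P t x y = 0.
Hypothesis mq : measurable_fun setT q.
Hypothesis q_ge0 : forall x, 0 <= q x.

Local Notation G := (perturbation_term m P q).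

Lemma perturbation_term_ge0 n t x z : 0 <= G n t x z.
Proof.
elim: n t x z => [|n IH] t x z //=.
apply: integral_ge0 => s _; apply: integral_ge0 => w _.
by rewrite !mule_ge0.
Qed.

Lemma perturbation_term_npos n t x z : (t <= 0)%R -> G n t x z = 0.
Proof.
move=> t0; case: n => [|n] /=; first exact: P_npos.
by rewrite set_itv_ge ?integral_set0// bnd_simp -leNgt.
Qed.

(** The integrand vanishes off []0, t[]: the first kernel does for [s <= 0], the second factor does
    once the remaining time [t - s] is nonpositive. The domain of integration then no longer depends
    on [t]. *)
Lemma perturbation_termS n t x z :
  G n.+1 t x z = \int[mu]_s \int[m]_w (P s x w * q w * G n (t - s)%R w z).
Proof.
rewrite /=; apply: integral_outside0 => s /= /negP.
rewrite in_itv/= negb_and -!leNgt => /orP[s0|ts].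
- by apply: integral0_eq => w _; rewrite P_npos// !mul0e.
- by apply: integral0_eq => w _; rewrite perturbation_term_npos ?mule0// subr_le0.
Qed.

Local Ltac mproj := repeat first
  [ exact: measurable_id | exact: measurable_fst | exact: measurable_snd
  | exact: measurable_cst
  | apply: (measurableT_comp measurable_fst) | apply: (measurableT_comp measurable_snd)
  | apply: (measurableT_comp mq)
  | apply: emeasurable_funM | apply: measurable_funB
  | refine (@measurable_kernel_comp P _ _ _ _ _ mP _ _ _) ].

(** In the whole-line form of the recursion [t] is only a parameter of the integrand, so joint
    measurability survives both integrations and passes from [n] to [n.+1]. *)
Lemma measurable_perturbation_term n :
  measurable_fun setT (fun u : GR * F * F => G n u.1.1 u.1.2 u.2).
Proof.
elim: n => [|n IH]; first exact: mP.
under eq_fun do rewrite perturbation_termS.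
apply: (@measurable_integral2 _ _ _ _ _ mu (fun (u : GR * F * F) (s : GR) =>
  \int[m]_w (P s u.1.2 w * q w * G n (u.1.1 - s)%R w u.2))); last first.
  by move=> u s; apply: integral_ge0 => w _; rewrite !mule_ge0// perturbation_term_ge0.
apply: (@measurable_integral2 _ _ _ _ _ m (fun (v : (GR * F * F) * GR) (w : F) =>
  P v.2 v.1.1.2 w * q w * G n (v.1.1.1 - v.2)%R w v.1.2)); last first.
  by move=> v w; rewrite !mule_ge0// perturbation_term_ge0.
mproj.
refine (@measurable_kernel_comp (G n) _ _ _ _ _ IH _ _ _); mproj.
Qed.

Local Ltac mproj' := repeat first [ progress mproj
  | refine (@measurable_kernel_comp (G _) _ _ _ _ _ (measurable_perturbation_term _) _ _ _) ].

Variable h : F -> \bar R.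
Hypothesis mh : measurable_fun setT h.
Hypothesis h_ge0 : forall x, 0 <= h x.

Lemma measurable_perturbation_term_section n t x :
  measurable_fun setT (fun z => G n t x z).
Proof.
by refine (@measurable_kernel_comp (G n) _ _ _ _ _
  (measurable_perturbation_term n) _ _ _); mproj.
Qed.

(** Duhamel's recursion for the functions [P^(n)_t h]. All factors are nonnegative, so Tonelli moves
    the [z]-integral first past [ds], then past [m(dw)], where only the last kernel and [h] depend
    on [z]. *)
Lemma integral_perturbation_termS n t x :
  \int[m]_z (G n.+1 t x z * h z) =
  \int[mu]_(s in `]0%R, t[) \int[m]_w
    (P s x w * q w * \int[m]_z (G n (t - s)%R w z * h z)).
Proof.
have mG := measurable_perturbation_term n.
have G0 := perturbation_term_ge0 n.
transitivity (\int[m]_z \int[mu]_s \int[m]_w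
    (P s x w * q w * G n (t - s)%R w z * h z)).
  apply: eq_integral => z _; rewrite perturbation_termS.
  rewrite -ge0_integralZr//; last 2 first.
  - apply: (@measurable_integral2 _ _ _ _ _ m (fun (s : GR) (w : F) =>
      P s x w * q w * G n (t - s)%R w z)); last by move=> s w; rewrite !mule_ge0.
    by mproj'.
  - by move=> s _; apply: integral_ge0 => w _; rewrite !mule_ge0.
  apply: eq_integral => s _; rewrite -ge0_integralZr//; last by move=> w _; rewrite !mule_ge0.
  by mproj'.
transitivity (\int[mu]_s \int[m]_w
    (P s x w * q w * \int[m]_z (G n (t - s)%R w z * h z))); last first.
  apply/esym/integral_outside0 => s /= /negP.
  rewrite in_itv/= negb_and -!leNgt => /orP[s0|ts].
  - by apply: integral0_eq => w _; rewrite P_npos// !mul0e.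
  - apply: integral0_eq => w _; rewrite integral0_eq ?mule0// => z _.
    by rewrite perturbation_term_npos ?mul0e// subr_le0.
rewrite (@tonelli_exchange _ _ _ _ _ m mu (fun z (s : GR) => \int[m]_w
    (P s x w * q w * G n (t - s)%R w z * h z))); last 2 first.
- apply: (@measurable_integral2 _ _ _ _ _ m (fun (u : F * GR) w =>
    P u.2 x w * q w * G n (t - u.2)%R w u.1 * h u.1)); last first.
    by move=> u w; rewrite !mule_ge0.
  apply: emeasurable_funM; last by apply: (measurableT_comp mh); mproj.
  by mproj'.
- by move=> z s; apply: integral_ge0 => w _; rewrite !mule_ge0.
apply: eq_integral => s _.
rewrite (@tonelli_exchange _ _ _ _ _ m m (fun z w =>
    P s x w * q w * G n (t - s)%R w z * h z)); last 2 first.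
- apply: emeasurable_funM; last by apply: (measurableT_comp mh); mproj.
  by mproj'.
- by move=> z w; rewrite !mule_ge0.
apply: eq_integral => w _.
under eq_integral do rewrite -muleA.
rewrite ge0_integralZl//.
- apply: emeasurable_funM => //; exact: measurable_perturbation_term_section.
- by move=> z _; rewrite mule_ge0.
- by rewrite mule_ge0.
Qed.

Hypothesis h_super : forall t x, (0 < t)%R ->
  \int[m]_z (P t x z * h z) +
  \int[mu]_(s in `]0%R, t[) \int[m]_w (P s x w * q w * h w) <= h x.

(** The term [i = 0] is [P_t h]. The terms [i.+1] add up, by Duhamel, to [\int_0^t P_s (q S) ds],
    where [S] is the sum of the first [n] terms at the remaining time [t - s > 0]; by induction
    [S <= h], and [h_super] concludes. The induction hypothesis is needed at all positive times and
    all points. *)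
Lemma sum_integral_perturbation_term_le n t x : (0 < t)%R ->
  \sum_(0 <= i < n) \int[m]_z (G i t x z * h z) <= h x.
Proof.
elim: n t x => [|n IH] t x t0; first by rewrite big_nil.
rewrite big_nat_recl//=; apply: (le_trans _ (h_super x t0)).
rewrite leeD2l//.
under eq_bigr do rewrite integral_perturbation_termS.
pose I i s w := \int[m]_z (G i (t - s)%R w z * h z).
have I0 i s w : 0 <= I i s w.
  by apply: integral_ge0 => z _; rewrite mule_ge0// perturbation_term_ge0.
have mI i : measurable_fun setT (fun u : GR * F => I i u.1 u.2).
  apply: (@measurable_integral2 _ _ _ _ _ m (fun (u : GR * F) z =>
    G i (t - u.1)%R u.2 z * h z)); last first.
    by move=> u z; rewrite mule_ge0// perturbation_term_ge0.
  apply: emeasurable_funM; last by apply: (measurableT_comp mh); mproj.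
  by refine (@measurable_kernel_comp (G i) _ _ _ _ _ (measurable_perturbation_term i) _ _ _); mproj.
have mIs i s : measurable_fun setT (fun w : F => I i s w).
  by apply: (@measurableT_comp _ _ _ _ _ _ (fun u : GR * F => I i u.1 u.2)
    _ (fun w => (s, w))) => //; exact: measurable_fun_pair.
(* The finite sum goes under both integrals, so that the induction hypothesis applies pointwise in
   [s] and [w]. *)
rewrite -(@ge0_integral_sum _ _ _ mu _ _ _
  (fun i s => \int[m]_w (P s x w * q w * I i s w)))//; last 2 first.
- move=> i; apply: measurable_funTS.
  apply: (@measurable_integral2 _ _ _ _ _ m (fun (s : GR) w => P s x w * q w * I i s w)).
    apply: emeasurable_funM; last exact: mI.
    by mproj'.
  by move=> s w; rewrite !mule_ge0.
- by move=> i s _; apply: integral_ge0 => w _; rewrite !mule_ge0.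
have mPq : measurable_fun setT (fun u : GR * F => P u.1 x u.2 * q u.2) by mproj'.
apply: ge0_le_integral => //.
- move=> s _; apply: sume_ge0 => i _; apply: integral_ge0 => w _.
  by rewrite !mule_ge0.
- apply: measurable_funTS; apply: emeasurable_sum => i.
  apply: (@measurable_integral2 _ _ _ _ _ m (fun (s : GR) w => P s x w * q w * I i s w)).
    by apply: emeasurable_funM; last exact: mI.
  by move=> s w; rewrite !mule_ge0.
- apply: measurable_funTS.
  apply: (@measurable_integral2 _ _ _ _ _ m (fun (s : GR) w => P s x w * q w * h w)).
    by apply: emeasurable_funM => //; apply: (measurableT_comp mh); mproj.
  by move=> s w; rewrite !mule_ge0.
move=> s /=; rewrite in_itv/= => /andP[s0 st].
have mPqs : measurable_fun setT (fun w => P s x w * q w) by mproj'.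
rewrite -ge0_integral_sum//; last 2 first.
- by move=> i; apply: emeasurable_funM.
- by move=> i w _; rewrite !mule_ge0.
apply: ge0_le_integral => //.
- by move=> w _; apply: sume_ge0 => i _; rewrite !mule_ge0.
- by apply: emeasurable_sum => i; apply: emeasurable_funM.
- exact: emeasurable_funM.
move=> w _.
rewrite [leLHS](_ : _ = P s x w * q w * \sum_(0 <= i < n) I i s w); last first.
  by rewrite ge0_sume_distrr.
rewrite lee_wpmul2l// ?mule_ge0//.
by apply: IH; rewrite subr_gt0.
Qed.

Lemma integral_perturbation_term_le t x : (0 < t)%R ->
  \int[m]_z (P t x z * h z) <= h x.
Proof.
move=> t0; have := sum_integral_perturbation_term_le 1 x t0.
by rewrite big_nat1.
Qed.

(** Domination of [w] by [B h] passes through each nonnegative kernel [P^(n)_t]; the bound on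
    partial sums for [h] is uniform in [n], so it survives the limit. The first conclusion is the
    term of order 0. *)
Lemma integral_schrodinger_perturbation_le (w : F -> R) (B : R) t x :
  measurable_fun setT w -> (forall z, 0 <= w z)%R -> (0 <= B)%R ->
  (forall z, (w z)%:E <= B%:E * h z) -> (0 < t)%R ->
  \int[m]_z (P t x z * (w z)%:E) <= B%:E * h x /\
  \int[m]_z (schrodinger_perturbation m P q t x z * (w z)%:E) <= B%:E * h x.
Proof.
move=> mw w0 B0 wh t0.
have mwE : measurable_fun setT (fun z => (w z)%:E) by exact/measurable_EFinP.
have we0 z : 0 <= (w z)%:E by rewrite lee_fin.
have mGs n : measurable_fun setT (fun z => G n t x z).
  exact: measurable_perturbation_term_section.
have G0 n z : 0 <= G n t x z by exact: perturbation_term_ge0.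
have step n : \int[m]_z (G n t x z * (w z)%:E) <=
    B%:E * \int[m]_z (G n t x z * h z).
  rewrite -(@ge0_integralZl_EFin _ _ _ m setT measurableT (fun z => G n t x z * h z) _ _ B)//.
  - apply: ge0_le_integral => //.
    + by move=> z _; rewrite mule_ge0.
    + exact: emeasurable_funM.
    + by apply: measurable_funeM; exact: emeasurable_funM.
    + by move=> z _; rewrite muleCA lee_wpmul2l.
  - by move=> z _; rewrite mule_ge0.
  - exact: emeasurable_funM.
split.
  apply: le_trans (step 0%N) _; apply: lee_wpmul2l; first by rewrite lee_fin.
  exact: integral_perturbation_term_le.
have -> : \int[m]_z (schrodinger_perturbation m P q t x z * (w z)%:E) =
    \sum_(0 <= n <oo) \int[m]_z (G n t x z * (w z)%:E).
  rewrite -integral_nneseries//.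
  - apply: eq_integral => z _; rewrite muleC -nneseriesZl//.
    by apply: eq_eseriesr => n _; rewrite muleC.
  - by move=> n; exact: emeasurable_funM.
  - by move=> n z _; rewrite mule_ge0.
apply: lime_le.
  by apply: is_cvg_nneseries => n _ _; apply: integral_ge0 => z _; rewrite mule_ge0.
apply: nearW => n.
apply: (@le_trans _ _ (B%:E * \sum_(0 <= i < n) \int[m]_z (G i t x z * h z))).
  rewrite ge0_sume_distrr; last by move=> i _; apply: integral_ge0 => z _; rewrite mule_ge0.
  by apply: lee_sum => i _; exact: step.
apply: lee_wpmul2l; first by rewrite lee_fin.
exact: sum_integral_perturbation_term_le.
Qed.

End Perturbation.

(** * Time integrals of reflected powers *)

Section PowerIntegrals.
Context {R : realType}.
Local Notation mu := (@lebesgue_measure R).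

Lemma is_derive_powR_reflect (r b s : R) : s < r ->
  is_derive s 1 (fun s => (r - s) `^ b) (- (b * (r - s) `^ (b - 1))).
Proof.
move=> sr.
have D1 : is_derive s (1 : R) (fun s => r - s) (- 1).
  have -> : (fun s : R => r - s) = (cst r - id) by apply/funext.
  by apply: is_derive_eq; rewrite sub0r.
have D2 : is_derive (r - s) 1 (@powR R ^~ b) (b * (r - s) `^ (b - 1)).
  by apply: is_derive1_powR; rewrite subr_gt0.
have := @is_derive1_comp _ (@powR R ^~ b) (fun s => r - s) s _ _ D2 D1.
by rewrite mulrN1.
Qed.

Lemma continuous_powR_reflect (r b s : R) : s < r ->
  {for s, continuous (fun s => (r - s) `^ b)}.
Proof.
move=> sr; apply/differentiable_continuous/derivable1_diffP.
by have [] := is_derive_powR_reflect b sr.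
Qed.

(** The fundamental theorem of calculus applies because [t < r] keeps [[0, t]] away from [s = r],
    where the integrand is singular when [b < 1]. *)
Lemma integral_powR_reflect (b r t : R) : 0 < t < r ->
  (\int[mu]_(s in `]0%R, t[) (b * (r - s) `^ (b - 1))%:E =
   (r `^ b - (r - t) `^ b)%:E)%E.
Proof.
move=> /andP[t0 tr].
have cF s : s < r -> {for s, continuous (fun s => - (r - s) `^ b)}.
  by move=> sr; apply: continuousN; exact: continuous_powR_reflect.
have cf s : s < r -> {for s, continuous (fun s => b * (r - s) `^ (b - 1))}.
  by move=> sr; apply: continuousM; [exact: cvg_cst|exact: continuous_powR_reflect].
have dF s : s < r -> is_derive s (1 : R) (fun s => - (r - s) `^ b) (b * (r - s) `^ (b - 1)).
  move=> sr; have := @is_deriveN _ _ _ _ _ _ _ (is_derive_powR_reflect b sr).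
  by rewrite opprK.
have wcf : {within [set` `[0, t]], continuous (fun s => b * (r - s) `^ (b - 1))}.
  apply: continuous_in_subspaceT => s; rewrite inE/= in_itv/= => /andP[_ st].
  by apply: cf; exact: le_lt_trans tr.
have := @continuous_FTC2 R (fun s => b * (r - s) `^ (b - 1))
  (fun s => - (r - s) `^ b) 0 t t0 wcf.
rewrite integral_itv_bndoo; last first.
  apply/measurable_EFinP/measurable_funTS/measurable_funM => //.
  by apply: (measurableT_comp (measurable_powR _)); exact: measurable_funB.
move=> ->.
- by rewrite subr0 -EFinB opprK addrC.
- split.
  + by move=> s; rewrite in_itv/= => /andP[_ st]; have [] := dF s (lt_trans st tr).
  + by apply: cvg_at_right_filter; apply: cF; exact: lt_trans tr.
  + by apply: cvg_at_left_filter; apply: cF.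
- move=> s; rewrite in_itv/= => /andP[_ st].
  by rewrite derive1E; have [_ ->] := dF s (lt_trans st tr).
Qed.

(* Weights and kernels are extended by 0 to nonpositive times, so that time
   integrals run over the whole line and Lebesgue shift invariance applies. *)
Definition powR_weight (c b u : R) : \bar R :=
  if 0 < u then (c * u `^ b)%:E else 0%E.

Lemma powR_weight_ge0 c b u : 0 <= c -> (0 <= powR_weight c b u)%E.
Proof.
by move=> c0; rewrite /powR_weight; case: ifP => // _; rewrite lee_fin mulr_ge0// powR_ge0.
Qed.

Lemma powR_weight_npos c b u : u <= 0 -> powR_weight c b u = 0%E.
Proof. by move=> u0; rewrite /powR_weight ltNge u0. Qed.

Lemma measurable_powR_weight c b :
  measurable_fun [set: measurableTypeR R] (powR_weight c b).
Proof.
apply: measurable_fun_ifT => //; last first.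
  by apply/measurable_EFinP/measurable_funM => //; exact: measurable_powR.
exact: measurable_fun_ltr.
Qed.

Local Open Scope ereal_scope.

Lemma integral_powR_weight_reflect (b r t : R) : (0 < b)%R -> (0 < t < r)%R ->
  \int[mu]_(s in `]0%R, t[) powR_weight b (b - 1) (r - s) =
   (r `^ b - (r - t) `^ b)%:E.
Proof.
move=> b0 /andP[t0 tr]; rewrite -integral_powR_reflect ?t0//.
apply: eq_integral => s; rewrite inE/= in_itv/= => /andP[_ st].
by rewrite /powR_weight subr_gt0 (lt_trans st tr).
Qed.

(** The end point [s = r] may be singular, so []0, r[] is exhausted by shorter intervals, on each of
    which the primitive gives at most [r^b]; monotone convergence carries the bound over. *)
Lemma integral_powR_weight_reflect_le (b r : R) : (0 < b)%R -> (0 < r)%R ->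
  \int[mu]_(s in `]0%R, r[) powR_weight b (b - 1) (r - s) <= (r `^ b)%:E.
Proof.
move=> b0 r0.
pose D (i : nat) : set R := [set` `]0%R, (r - r / i.+1%:R)%R[].
have DE : [set` `]0%R, r[] = \bigcup_i D i.
  apply/seteqP; split => s /=.
    rewrite in_itv/= => /andP[s0 sr].
    (* Any [i] with [r / (r - s) < i + 1] puts [s] below [r - r / (i + 1)]. *)
    exists (Num.truncn (r / (r - s))) => //; rewrite /D/= in_itv/= s0/=.
    rewrite ltrBrDl -ltrBrDr ltr_pdivrMr// mulrC -ltr_pdivrMr ?subr_gt0//.
    exact: truncnS_gt.
  move=> [i _]; rewrite /D/= !in_itv/= => /andP[-> sr]/=.
  by rewrite (lt_le_trans sr)// gerBl divr_ge0// ltW.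
have mw : measurable_fun [set: measurableTypeR R] (fun s => powR_weight b (b - 1) (r - s)).
  apply: (@measurableT_comp _ _ _ _ _ _ (powR_weight b (b - 1)) _
    (fun s : measurableTypeR R => (r - s)%R : measurableTypeR R)).
    exact: measurable_powR_weight.
  exact: measurable_funB.
have ndD : nondecreasing_seq D.
  move=> i j ij; rewrite subsetEset; apply: subset_itvl; rewrite bnd_simp.
  by rewrite lerD2l lerN2 ler_pM2l// lef_pV2 ?posrE// ler_nat.
rewrite DE.
have cv := @ge0_nondecreasing_set_cvg_integral _ (measurableTypeR R) R D
  (fun s => powR_weight b (b - 1) (r - s)) mu ndD.
apply: (cvge_to_le (cv _ _ _)).
- by move=> i; exact: measurable_itv.
- by move=> i; exact: measurable_funTS.
- by move=> i s _; apply: powR_weight_ge0; exact: ltW.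
(* At [i = 0] the interval is []0, 0[], hence empty, and the formula for [0 < t < r] does not apply
   to it. *)
apply: nearW => -[|i].
  rewrite /D divr1 subrr set_itv_ge ?integral_set0 ?lee_fin ?powR_ge0//.
  by rewrite bnd_simp ltxx.
rewrite integral_powR_weight_reflect// ?lee_fin ?gerBl ?powR_ge0//.
rewrite subr_gt0 ltr_pdivrMr// ltr_pMr// ltr1n/= ltrBlDr ltrDl divr_gt0//.
Qed.

(* Integrated against the heat kernel, this is the excess inequality
   [P_t h + \int_0^t P_s k ds <= h]. *)
Lemma powR_weight_split (b t r : R) : (0 < b)%R -> (0 < t)%R -> (0 < r)%R ->
  powR_weight 1 b (r - t) +
  \int[mu]_(s in `]0%R, t[) powR_weight b (b - 1) (r - s) <= powR_weight 1 b r.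
Proof.
move=> b0 t0 r0; have [tr|rt] := ltP t r.
  rewrite integral_powR_weight_reflect ?t0// /powR_weight subr_gt0 tr r0.
  by rewrite !mul1r -EFinD lee_fin addrC subrK.
(* When [r <= t] the shifted weight vanishes and so does the integrand for [s >= r]: only []0, r[]
   contributes. *)
rewrite powR_weight_npos ?subr_le0// add0e /powR_weight r0 mul1r.
apply: le_trans (integral_powR_weight_reflect_le b0 r0).
rewrite [leRHS]integral_mkcond [leLHS]integral_mkcond.
rewrite le_eqVlt; apply/orP; left; apply/eqP; apply: eq_integral => s _.
rewrite !patchE !mem_setE !in_itv/=; case: (ltP 0%R s) => //= s0.
have [sr|rs] := ltP s r; first by rewrite (lt_le_trans sr rt).
by rewrite subr_gt0 (ltNge s r) rs; case: ifP.
Qed.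

End PowerIntegrals.

(** * Potentials of powers of time and their excess inequality *)

Section Potentials.
Local Open Scope ereal_scope.
Context {d : measure_display} {R : realType} {F : measurableMetricType d R}.
Variable m : {sigma_finite_measure set F -> \bar R}.
Local Notation GR := (measurableTypeR R).
Local Notation mu := (@lebesgue_measure R).

Variable P : R -> F -> F -> \bar R.
Hypothesis mP : measurable_fun setT (fun u : GR * F * F => P u.1.1 u.1.2 u.2).
Hypothesis P_ge0 : forall t x y, 0 <= P t x y.
Hypothesis P_npos : forall t x y, (t <= 0)%R -> P t x y = 0.
Hypothesis P_semigroup : forall s t x z, (0 < s)%R -> (0 < t)%R ->
  \int[m]_y (P s x y * P t y z) = P (s + t)%R x z.

(** Common form of the two potentials: [c = 1], [b = beta] gives [h_y(x)], and [c = beta],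
    [b = beta - 1] gives [k_y(x)]. *)
Definition powR_potential (c b : R) (y x : F) : \bar R :=
  \int[mu]_t (powR_weight c b t * P t x y).

Lemma powR_potential_ge0 c b y x : (0 <= c)%R -> 0 <= powR_potential c b y x.
Proof. by move=> c0; apply: integral_ge0 => t _; rewrite mule_ge0// powR_weight_ge0. Qed.

Lemma measurable_powR_potential c b y : (0 <= c)%R ->
  measurable_fun setT (powR_potential c b y).
Proof.
move=> c0; apply: (@measurable_integral2 _ _ _ _ _ mu (fun (x : F) (t : GR) =>
  powR_weight c b t * P t x y)); last by move=> x t; rewrite mule_ge0// powR_weight_ge0.
apply: emeasurable_funM.
  exact: (measurableT_comp (measurable_powR_weight c b) measurable_snd).
by refine (@measurable_kernel_comp _ _ _ P _ _ _ _ _ mP _ _ _).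
Qed.

(** Chapman-Kolmogorov merges [P_t] and [P_r] into [P_(t + r)]; translating the time variable by [t]
    then moves the shift from the kernel to the weight. *)
Lemma integral_powR_potential c b t x y : (0 <= c)%R -> (0 < t)%R ->
  \int[m]_z (P t x z * powR_potential c b y z) =
  \int[mu]_r (powR_weight c b (r - t)%R * P r x y).
Proof.
move=> c0 t0.
have w0 r : 0 <= powR_weight c b r by exact: powR_weight_ge0.
transitivity (\int[m]_z \int[mu]_r (P t x z * (powR_weight c b r * P r z y))).
  apply: eq_integral => z _; rewrite ge0_integralZl//.
  - apply: emeasurable_funM; first exact: measurable_powR_weight.
    by refine (@measurable_kernel_comp _ _ _ P _ _ _ _ _ mP _ _ _).
  - by move=> r _; rewrite mule_ge0.
rewrite (@tonelli_exchange _ _ _ _ _ m mu (fun z (r : GR) =>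
    P t x z * (powR_weight c b r * P r z y))); last 2 first.
- apply: emeasurable_funM.
    by refine (@measurable_kernel_comp _ _ _ P _ _ _ _ _ mP _ _ _).
  apply: emeasurable_funM.
    exact: (measurableT_comp (measurable_powR_weight c b) measurable_snd).
  by refine (@measurable_kernel_comp _ _ _ P _ _ _ _ _ mP _ _ _).
- by move=> z r; rewrite !mule_ge0.
rewrite -(@ge0_integral_shift _ t (fun r => powR_weight c b (r - t) * P r x y)).
- apply: eq_integral => r _; rewrite addrK.
  under eq_integral do rewrite muleCA.
  rewrite ge0_integralZl//.
  + have [r0|r0] := leP r 0%R; first by rewrite powR_weight_npos// !mul0e.
    by rewrite P_semigroup// addrC.
  + apply: emeasurable_funM.
      by refine (@measurable_kernel_comp _ _ _ P _ _ _ _ _ mP _ _ _).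
    by refine (@measurable_kernel_comp _ _ _ P _ _ _ _ _ mP _ _ _).
  + by move=> z _; rewrite mule_ge0.
- apply: emeasurable_funM.
    apply: (@measurableT_comp _ _ _ _ _ _ (powR_weight c b) _ (fun r : GR => (r - t)%R : GR)).
      exact: measurable_powR_weight.
    exact: measurable_funB.
  by refine (@measurable_kernel_comp _ _ _ P _ _ _ _ _ mP _ _ _).
- by move=> r; rewrite mule_ge0.
Qed.

(** Each term on the left is a time integral of the same [P r x y] against an explicit weight, so
    the inequality follows from [powR_weight_split] for each [r]. *)
Lemma powR_potential_excess b t x y : (0 < b)%R -> (0 < t)%R ->
  \int[m]_z (P t x z * powR_potential 1 b y z) +
  \int[mu]_(s in `]0%R, t[) \int[m]_w (P s x w * powR_potential b (b - 1) y w)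
  <= powR_potential 1 b y x.
Proof.
move=> b0 t0.
have w0 r : 0 <= powR_weight b (b - 1) r by apply: powR_weight_ge0; exact: ltW.
have w1 r : 0 <= powR_weight 1 b r by exact: powR_weight_ge0.
have mPr : measurable_fun [set: GR] (fun r => P r x y).
  by refine (@measurable_kernel_comp _ _ _ P _ _ _ _ _ mP _ _ _).
have mwt c e s : measurable_fun [set: GR] (fun r => powR_weight c e (r - s)%R).
  apply: (@measurableT_comp _ _ _ _ _ _ (powR_weight c e) _ (fun r : GR => (r - s)%R : GR)).
    exact: measurable_powR_weight.
  exact: measurable_funB.
have mw2 : measurable_fun [set: GR * GR] (fun u => powR_weight b (b - 1) (u.2 - u.1)%R).
  apply: (@measurableT_comp _ _ _ _ _ _ (powR_weight b (b - 1)) _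
    (fun u : GR * GR => (u.2 - u.1)%R : GR)).
    exact: measurable_powR_weight.
  exact: measurable_funB.
(* Indicator of []0, t[]: as a factor of the integrand it lets Tonelli run over the whole line in
   both times. *)
pose I : GR -> \bar R := fun s => if (0 < s < t)%R then 1 else 0.
have I0 s : 0 <= I s by rewrite /I; case: ifP.
have mI : measurable_fun setT I.
  apply: measurable_fun_ifT => //.
  by apply: measurable_and; exact: measurable_fun_ltr.
have IE (f : R -> \bar R) : \int[mu]_(s in `]0%R, t[) f s = \int[mu]_s (I s * f s).
  rewrite integral_mkcond; apply: eq_integral => s _.
  rewrite patchE mem_setE in_itv/= /I; case: ifP => _; rewrite ?mul1e ?mul0e//.
have E1 := @integral_powR_potential 1%R b t x y ler01 t0.
have E2 : \int[mu]_(s in `]0%R, t[) \int[m]_w (P s x w * powR_potential b (b - 1) y w) =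
    \int[mu]_r ((\int[mu]_(s in `]0%R, t[) powR_weight b (b - 1) (r - s)) * P r x y).
  rewrite IE; transitivity (\int[mu]_s \int[mu]_r
      (I s * (powR_weight b (b - 1) (r - s)%R * P r x y))).
    apply: eq_integral => s _.
    rewrite ge0_integralZl//; last 2 first.
    - exact: emeasurable_funM.
    - by move=> r _; rewrite mule_ge0.
    have [s0|s0] := leP s 0%R; first by rewrite /I ltNge s0 !mul0e.
    congr (_ * _); exact: (@integral_powR_potential b (b - 1)%R s x y (ltW b0) s0).
  rewrite (@tonelli_exchange _ _ _ _ _ mu mu (fun s r : GR =>
    I s * (powR_weight b (b - 1) (r - s)%R * P r x y))); last 2 first.
  - apply: emeasurable_funM; first exact: (measurableT_comp mI measurable_fst).
    apply: emeasurable_funM => //.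
    exact: (measurableT_comp mPr measurable_snd).
  - by move=> s r; rewrite !mule_ge0.
  apply: eq_integral => r _; rewrite IE -ge0_integralZr//.
  - by apply: eq_integral => s _; rewrite muleA.
  - apply: emeasurable_funM => //.
    apply: (@measurableT_comp _ _ _ _ _ _ (powR_weight b (b - 1)) _ (fun s : GR => (r - s)%R : GR)).
      exact: measurable_powR_weight.
    exact: measurable_funB.
  - by move=> s _; rewrite mule_ge0.
have mB : measurable_fun [set: GR] (fun r =>
    \int[mu]_(s in `]0%R, t[) powR_weight b (b - 1) (r - s)).
  under eq_fun do rewrite IE.
  apply: (@measurable_integral2 _ _ _ _ _ mu (fun r s : GR =>
    I s * powR_weight b (b - 1) (r - s)%R)); last by move=> r s; rewrite mule_ge0.
  apply: emeasurable_funM; first exact: (measurableT_comp mI measurable_snd).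
  apply: (@measurableT_comp _ _ _ _ _ _ (powR_weight b (b - 1)) _
    (fun u : GR * GR => (u.1 - u.2)%R : GR)).
    exact: measurable_powR_weight.
  exact: measurable_funB.
have B0 r : 0 <= \int[mu]_(s in `]0%R, t[) powR_weight b (b - 1) (r - s).
  by apply: integral_ge0.
have eq_le (u v : \bar R) : u = v -> u <= v by move=> ->.
refine (le_trans (leeD (eq_le _ _ E1) (eq_le _ _ E2)) _).
rewrite -ge0_integralD//; last 4 first.
- by move=> r _; rewrite mule_ge0.
- exact: emeasurable_funM.
- by move=> r _; rewrite mule_ge0.
- exact: emeasurable_funM.
apply: ge0_le_integral => //.
- by move=> r _; rewrite adde_ge0// mule_ge0.
- by apply: emeasurable_funD; exact: emeasurable_funM.
- by apply: emeasurable_funM => //; exact: measurable_powR_weight.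
move=> r _; have [r0|r0] := leP r 0%R; first by rewrite P_npos// !mule0 adde0.
rewrite -ge0_muleDl//; apply: lee_wpmul2r => //.
exact: powR_weight_split.
Qed.

(** The operators [P_s] have densities with respect to [m], so [q h <= k] is only needed almost
    everywhere; this tolerates the pole of [q]. *)
Lemma perturbed_excess (q h k : F -> \bar R) t x :
  measurable_fun setT q -> (forall x, 0 <= q x) ->
  measurable_fun setT h -> (forall x, 0 <= h x) ->
  measurable_fun setT k -> (forall x, 0 <= k x) ->
  {ae m, forall x, q x * h x <= k x} ->
  \int[m]_z (P t x z * h z) +
  \int[mu]_(s in `]0%R, t[) \int[m]_w (P s x w * k w) <= h x ->
  \int[m]_z (P t x z * h z) +
  \int[mu]_(s in `]0%R, t[) \int[m]_w (P s x w * q w * h w) <= h x.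
Proof.
move=> mq q0 mh h0 mk k0 qhk; apply: le_trans.
have ms (f : F -> \bar R) : measurable_fun setT f ->
    measurable_fun setT (fun u : GR * F => f u.2).
  by move=> mf; exact: (measurableT_comp mf measurable_snd).
have mPx : measurable_fun setT (fun u : GR * F => P u.1 x u.2).
  by refine (@measurable_kernel_comp _ _ _ P _ _ _ _ _ mP _ _ _).
have mPsx s : measurable_fun setT (fun z : F => P s x z).
  by refine (@measurable_kernel_comp _ _ _ P _ _ _ _ _ mP _ _ _).
apply: leeD; first exact: lexx.
apply: ge0_le_integral.
- exact: measurable_itv.
- by move=> s _; apply: integral_ge0 => w _; rewrite !mule_ge0.
- apply: measurable_funTS.
  apply: (@measurable_integral2 _ _ _ _ _ m (fun (s : GR) w =>
    P s x w * q w * h w)); last by move=> s w; rewrite !mule_ge0.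
  by apply: emeasurable_funM; [apply: emeasurable_funM => //; exact: ms|exact: ms].
- apply: measurable_funTS.
  apply: (@measurable_integral2 _ _ _ _ _ m (fun (s : GR) w =>
    P s x w * k w)); last by move=> s w; rewrite mule_ge0.
  by apply: emeasurable_funM => //; exact: ms.
move=> s _; apply: ae_ge0_le_integral.
- exact: measurableT.
- by move=> w _; rewrite !mule_ge0.
- by apply: emeasurable_funM => //; exact: emeasurable_funM.
- by move=> w _; rewrite mule_ge0.
- exact: emeasurable_funM.
apply: filterS qhk => w qhkw _; rewrite -muleA.
exact: lee_wpmul2l.
Qed.

End Potentials.

(** * Tail integrals of negative powers *)

Section PowerTail.
Context {R : realType}.
Local Notation mu := (@lebesgue_measure R).

Lemma powR_cvgy0 (s : R) : 0 < s -> x `^ (- s) @[x --> +oo] --> (0 : R).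
Proof.
move=> s0; apply/cvgrPdist_lt => e e0; near=> x.
have x0 : 0 < x by near: x; exact: nbhs_pinfty_gt.
rewrite sub0r normrN ger0_norm ?powR_ge0// powRN -[ltRHS]invrK.
rewrite ltf_pV2 ?posrE ?invr_gt0 ?powR_gt0//.
rewrite -[ltLHS](powRr1 (ltW _)) ?invr_gt0// -(mulVf (lt0r_neq0 s0)) powRrM.
rewrite gt0_ltr_powR ?nnegrE ?powR_ge0 ?(ltW x0)//.
Unshelve. all: by end_near. Qed.

Lemma continuous_powR (b x : R) : 0 < x -> {for x, continuous (fun t => t `^ b)}.
Proof.
move=> x0; apply/differentiable_continuous/derivable1_diffP.
by have [] := is_derive1_powR b x0.
Qed.

Lemma integral_powR_tail (a s : R) : 0 < a -> 0 < s ->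
  (\int[mu]_(t in `[a, +oo[) (t `^ (- s - 1))%:E = (a `^ (- s) / s)%:E)%E.
Proof.
move=> a0 s0.
have dF (x : R) : 0 < x -> is_derive x (1 : R) (fun t => - s^-1 * t `^ (- s)) (x `^ (- s - 1)).
  move=> x0.
  have := @is_deriveZ _ _ _ (fun t => t `^ (- s)) (- s^-1) x 1 _ (is_derive1_powR (- s) x0).
  by rewrite /GRing.scale/= mulrA mulrNN mulVf ?gt_eqF// mul1r.
rewrite (@ge0_continuous_FTC2y _ (fun t => t `^ (- s - 1)) (fun t => - s^-1 * t `^ (- s)) a 0).
- by rewrite -EFinB sub0r mulNr opprK mulrC.
- by move=> x _; exact: powR_ge0.
- apply: continuous_in_subspaceT => x; rewrite inE/= in_itv/= andbT => ax.
  by apply: continuous_powR; exact: lt_le_trans ax.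
- rewrite -[X in _ --> X](mulr0 (- s^-1)); apply: cvgM; first exact: cvg_cst.
  exact: powR_cvgy0.
- by move=> x ax; have [] := dF x (lt_trans a0 ax).
- apply: cvg_at_right_filter; apply: cvgM; first exact: cvg_cst.
  exact: continuous_powR.
- move=> x; rewrite in_itv/= andbT => ax.
  by rewrite derive1E; have [_ ->] := dF x (lt_trans a0 ax).
Qed.

End PowerTail.

(** * The generalized inverse of [phi] and bounds on the kernel profile *)

Section Profile.
Context {R : realType}.
Variables (phi V : R -> R) (lA lC al cl : R).
Hypothesis phi_scale : scale_function phi.
Hypothesis V_scale : scale_function V.
Hypothesis phi_infty : phi x @[x --> +oo] --> +oo.
Hypothesis lA_gt0 : 0 < lA.
Hypothesis al_gt0 : 0 < al.
Hypothesis V_wlsc : wlsc lA lC V.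
Hypothesis phi_wusc : wusc al cl phi.

Let phi_le x y : 0 <= x -> x <= y -> phi x <= phi y.
Proof.
case: phi_scale => h _ _ x0 xy; apply: h => //; rewrite in_itv/= andbT//.
exact: le_trans xy.
Qed.

Let V_le x y : 0 <= x -> x <= y -> V x <= V y.
Proof.
case: V_scale => h _ _ x0 xy; apply: h => //; rewrite in_itv/= andbT//.
exact: le_trans xy.
Qed.

Let V_gt0 x : 0 < x -> 0 < V x. Proof. by case: V_scale => _ + _; exact. Qed.
Let phi_gt0 x : 0 < x -> 0 < phi x. Proof. by case: phi_scale => _ + _; exact. Qed.

Lemma scale_function_ge0 (f : R -> R) x : scale_function f -> 0 <= x -> 0 <= f x.
Proof.
by move=> [_ fp f0]; rewrite le_eqVlt => /predU1P[<-|/fp/ltW//]; rewrite f0.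
Qed.

Lemma rinv_le r t : 0 < r -> t < phi r -> rinv phi t <= r.
Proof. by move=> r0 tr; apply: ge_inf => //; exists 0 => s [/ltW]. Qed.

(** Monotonicity of [phi] makes [r] a lower bound of the set defining the inverse. Divergence of
    [phi] makes that set nonempty, which matters because the infimum of the empty set defaults to
    0. *)
Lemma le_rinv r t : 0 <= r -> phi r <= t -> r <= rinv phi t.
Proof.
move=> r0 rt; apply: lb_le_inf.
  have [M [_ MP]] := phi_infty (nbhs_pinfty_gt (num_real t)).
  exists (Num.max M 0 + 1); split.
    by rewrite ltr_wpDl// le_max lexx orbT.
  by apply: MP; rewrite ltr_pwDr// le_max lexx.
move=> s [s0 ts]; rewrite leNgt; apply/negP => sr.
have := phi_le (ltW s0) (ltW sr); rewrite leNgt => /negP; apply.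
exact: le_lt_trans ts.
Qed.

Lemma rinv_ge0 t : 0 <= t -> 0 <= rinv phi t.
Proof. by move=> t0; apply: le_rinv => //; case: phi_scale => _ _ ->. Qed.

(** Upper scaling of [phi] gives [phi (th * r) <= t] for a suitable dilation [th], hence
    [th * r <= rinv phi t]; lower scaling of [V] then gains the factor [th^lA]. *)
Lemma V_rinv_ge r t : 0 < r -> phi r <= t ->
  lC * (t / (cl * phi r)) `^ (lA / al) * V r <= V (rinv phi t).
Proof.
move=> r0 rt.
have [/andP[C0 C1] hV] := V_wlsc; have [cl1 hphi] := phi_wusc.
have cl0 : 0 < cl by exact: lt_le_trans cl1.
have f0 := phi_gt0 r0; have v0 := V_gt0 r0.
have t0 : 0 < t by exact: lt_le_trans rt.
have [le1|lt1] := leP 1 (t / (cl * phi r)).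
  (* The solution of [cl * th^al * phi r = t]; it is at least 1 in this case, as the scaling
     conditions require. *)
  pose th := (t / (cl * phi r)) `^ al^-1.
  have th1 : 1 <= th.
    have ai0 : 0 <= al^-1 by rewrite invr_ge0 ltW.
    by have := ler_powR le1 ai0; rewrite powRr0.
  have thE : th `^ al = t / (cl * phi r).
    rewrite /th -powRrM.  rewrite mulVf ?gt_eqF//.  by rewrite powRr1// (le_trans ler01 le1).
  have thA : th `^ lA = (t / (cl * phi r)) `^ (lA / al) by rewrite /th -powRrM (mulrC _ lA).
  have thr0 : 0 <= th * r by rewrite mulr_ge0 ?powR_ge0// ltW.
  rewrite -thA; apply: le_trans (hV _ _ th1 r0) _.
  apply: V_le => //; apply: le_rinv => //.
  apply: le_trans (hphi _ _ th1 r0) _.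
  suff -> : cl * th `^ al * phi r = t by [].
  by rewrite thE mulrAC mulrC divfK// gt_eqF// mulr_gt0.
(* Otherwise [t < cl * phi r]: both prefactors are at most 1 and monotonicity of [V] suffices. *)
apply: (@le_trans _ _ (V r)); last first.
  by apply: V_le; [exact: ltW|apply: le_rinv => //; exact: ltW].
have u0 : 0 <= t / (cl * phi r) by rewrite divr_ge0 ?mulr_ge0 ?(ltW cl0) ?(ltW f0) ?(ltW t0).
have g0 : 0 <= lA / al by rewrite divr_ge0 ?ltW.
have p1 : (t / (cl * phi r)) `^ (lA / al) <= 1.
  have := ge0_ler_powR g0 (u0 : _ \is Num.nneg) (ler01 : 1 \is Num.nneg) (ltW lt1).
  by rewrite powR1.
by rewrite ger_pMl// mulr_ile1 ?powR_ge0 ?(ltW C0).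
Qed.

Context {d : measure_display} {F : measurableMetricType d R}.
Local Open Scope ereal_scope.

Lemma kernel_profile_le_jump t (x y : F) : (0 < mdist x y)%R ->
  kernel_profile phi V t x y <= (t / (V (mdist x y) * phi (mdist x y)))%:E.
Proof.
move=> r0; rewrite /kernel_profile ge_min (inver (_ * _)%R) gt_eqF ?mulr_gt0 ?V_gt0 ?phi_gt0//.
by rewrite EFinM lexx orbT.
Qed.

(** Before time [phi (mdist x y)] the jump term is the smaller one: [rinv phi t <= mdist x y] bounds
    [V (rinv phi t)] by [V (mdist x y)], and the remaining factor [t / phi (mdist x y)] is below
    1. *)
Lemma kernel_profile_ge t (x y : F) : (0 < mdist x y)%R ->
  (0 < t < phi (mdist x y))%R ->
  (t / (V (mdist x y) * phi (mdist x y)))%:E <= kernel_profile phi V t x y.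
Proof.
move=> r0 /andP[t0 tf]; have f0 := phi_gt0 r0; have v0 := V_gt0 r0.
(* If [phi] jumps at 0, [rinv phi t] can be 0 and the first entry of the minimum is then [+oo]; this
   case is split off below. *)
rewrite /kernel_profile le_min; apply/andP; split; last first.
  by rewrite inver gt_eqF ?mulr_gt0// EFinM.
rewrite inver; case: ifPn => [|un0]; first by rewrite leey.
have u0 : (0 < V (rinv phi t))%R.
  by rewrite lt_neqAle eq_sym un0 scale_function_ge0// rinv_ge0// ltW.
rewrite lee_fin ler_pdivrMr ?mulr_gt0//.
apply: (@le_trans _ _ (phi (mdist x y))); first exact: ltW.
rewrite mulrA ler_peMl ?(ltW f0)// mulrC -ler_pdivrMr ?invr_gt0// mul1r.
rewrite invrK; apply: V_le; first by rewrite rinv_ge0// ltW.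
exact: rinv_le.
Qed.

(** After time [phi (mdist x y)] the on-diagonal term is used: by [V_rinv_ge] it decays like
    [t^(- lA / al)]. *)
Lemma kernel_profile_le_tail t (x y : F) : (0 < mdist x y)%R ->
  (phi (mdist x y) <= t)%R ->
  kernel_profile phi V t x y <=
  ((lC * V (mdist x y))^-1 * (cl * phi (mdist x y)) `^ (lA / al) * t `^ (- (lA / al)))%:E.
Proof.
move=> r0 ft; have f0 := phi_gt0 r0; have v0 := V_gt0 r0.
have t0 : (0 < t)%R by exact: lt_le_trans ft.
have [/andP[C0 C1] _] := V_wlsc; have [cl1 _] := phi_wusc.
have cl0 : (0 < cl)%R by exact: lt_le_trans cl1.
have H := V_rinv_ge r0 ft.
set g := (lA / al)%R in H *.
have b0 : (0 < lC * (t / (cl * phi (mdist x y))) `^ g * V (mdist x y))%R.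
  by rewrite !mulr_gt0// powR_gt0// divr_gt0// mulr_gt0.
have u0 := lt_le_trans b0 H.
rewrite /kernel_profile ge_min; apply/orP; left.
rewrite inver gt_eqF// lee_fin.
rewrite [leRHS](_ : _ = (lC * (t / (cl * phi (mdist x y))) `^ g * V (mdist x y))^-1)%R.
  by rewrite lef_pV2 ?posrE.
rewrite (@powRM _ t) ?(ltW t0)// ?invr_ge0 ?mulr_ge0 ?(ltW cl0) ?(ltW f0)//.
rewrite powRN.
have -> : ((cl * phi (mdist x y))^-1 `^ g = ((cl * phi (mdist x y)) `^ g)^-1)%R.
  by rewrite -powR_inv1 ?mulr_ge0 ?(ltW cl0) ?(ltW f0)// -powRrM mulN1r powRN.
have p1 : (t `^ g != 0)%R by rewrite gt_eqF// powR_gt0.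
have p2 : ((cl * phi (mdist x y)) `^ g != 0)%R by rewrite gt_eqF// powR_gt0// mulr_gt0.
by field; rewrite p1 p2 !gt_eqF.
Qed.

End Profile.

(** * Two-sided bounds on the potentials *)

Section PotentialBounds.
Local Open Scope ereal_scope.
Context {R : realType} {d : measure_display} {F : measurableMetricType d R}.
Local Notation GR := (measurableTypeR R).
Local Notation mu := (@lebesgue_measure R).
Variables (phi V : R -> R) (lA lC al cl : R).
Hypothesis phi_scale : scale_function phi.
Hypothesis V_scale : scale_function V.
Hypothesis phi_infty : phi x @[x --> +oo%R] --> +oo%R.
Hypothesis lA_gt0 : (0 < lA)%R.
Hypothesis al_gt0 : (0 < al)%R.
Hypothesis V_wlsc : wlsc lA lC V.
Hypothesis phi_wusc : wusc al cl phi.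
Variable P : R -> F -> F -> \bar R.
Hypothesis mP : measurable_fun setT (fun u : GR * F * F => P u.1.1 u.1.2 u.2).
Hypothesis P_ge0 : forall t x y, 0 <= P t x y.
Variable c : R.
Hypothesis c_gt0 : (0 < c)%R.
Hypothesis P_approx : forall (t : R) (x y : F), (0 < t)%R ->
  (c^-1)%:E * kernel_profile phi V t x y <= P t x y <= c%:E * kernel_profile phi V t x y.

Let V_gt0 x : (0 < x)%R -> (0 < V x)%R. Proof. by case: V_scale => _ + _; exact. Qed.
Let phi_gt0 x : (0 < x)%R -> (0 < phi x)%R. Proof. by case: phi_scale => _ + _; exact. Qed.

Let measurable_integrand c0 b x y :
  measurable_fun [set: GR] (fun t => powR_weight c0 b t * P t x y).
Proof.
apply: emeasurable_funM; first exact: measurable_powR_weight.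
by refine (@measurable_kernel_comp _ _ _ P _ _ _ _ _ mP _ _ _).
Qed.

(** Times between [phi / 2] and [phi] already give the right order. The jump bound contributes a
    factor [t], so only the sign of [b + 1] matters; this covers [b = beta - 1] with [beta < 1]. *)
Lemma powR_potential_lower c0 b x y : (0 <= c0)%R -> (0 <= b + 1)%R ->
  (0 < mdist x y)%R ->
  (c^-1 * c0 * 2^-1 `^ (b + 1) * 2^-1 *
    (phi (mdist x y) `^ (b + 1) / V (mdist x y)))%:E <=
  powR_potential P c0 b y x.
Proof.
move=> c00 b0 r0; have f0 := phi_gt0 r0; have v0 := V_gt0 r0.
set f := phi _ in f0 *; set v := V _ in v0 *.
pose D : set R := [set` `]f / 2, f[%R].
have f20 : (0 < f / 2)%R by rewrite divr_gt0.
(* The lower bound of the integrand at the left end [t = f / 2], its minimum there because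
   [b + 1 >= 0]. *)
pose K := (c^-1 * c0 * (f / 2) `^ (b + 1) / (v * f))%R.
have K0 : (0 <= K)%R.
  by rewrite /K !mulr_ge0 ?invr_ge0 ?powR_ge0 ?mulr_ge0// ?ltW.
apply: (@le_trans _ _ (\int[mu]_(t in D) K%:E)).
  have muD : mu D = (f / 2)%:E.
    rewrite lebesgue_measure_itv/= lte_fin ltr_pdivrMr// ltr_pMr// ltr1n -EFinB.
    by congr (_%:E); lra.
  rewrite integral_cst//=; last exact: measurable_itv.
  rewrite [X in _ * X]muD -EFinM lee_fin /K.
  rewrite powRM ?(ltW f0)//.
  rewrite le_eqVlt; apply/orP; left; apply/eqP.
  by field; rewrite !gt_eqF.
apply: (@le_trans _ _ (\int[mu]_(t in D) (powR_weight c0 b t * P t x y))); last first.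
  apply: ge0_subset_integral => //.
  - exact: measurable_itv.
  - by move=> t _; rewrite mule_ge0// powR_weight_ge0.
apply: ge0_le_integral.
- exact: measurable_itv.
- by move=> t _; rewrite lee_fin.
- exact: measurable_cst.
- exact: measurable_funTS.
move=> t; rewrite /D/= in_itv/= => /andP[ft tf].
have t0 : (0 < t)%R by exact: lt_trans ft.
rewrite /powR_weight t0.
have /andP[Plo _] := P_approx x y t0.
have klo := kernel_profile_ge phi_scale V_scale phi_infty r0 (introT andP (conj t0 tf)).
apply: (@le_trans _ _ ((c0 * t `^ b)%:E * ((c^-1)%:E * (t / (v * f))%:E))).
  rewrite -!EFinM lee_fin.
  have -> : (c0 * t `^ b * (c^-1 * (t / (v * f))) = c^-1 * c0 * (t `^ b * t) / (v * f))%R by ring.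
  have -> : (t `^ b * t = t `^ (b + 1))%R.
    by rewrite powRD ?powRr1 ?(ltW t0)//; apply/implyP => _; rewrite gt_eqF.
  rewrite ler_pM2r ?invr_gt0 ?mulr_gt0// ler_wpM2l ?mulr_ge0 ?invr_ge0 ?(ltW c_gt0)//.
  by rewrite ge0_ler_powR// ?nnegrE ltW.
apply: lee_wpmul2l; first by rewrite lee_fin mulr_ge0// powR_ge0.
apply: le_trans Plo; apply: lee_wpmul2l => //.
by rewrite lee_fin invr_ge0 ltW.
Qed.

(** The time integral is cut at [phi (mdist x y)]: the jump bound controls small times and yields
    the summand 1 of the constant, the on-diagonal decay controls large times and yields the other.
    Both parts have order [phi^(b + 1) / V]. *)
Lemma powR_potential_upper b x y : (0 < b)%R -> (b < lA / al - 1)%R ->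
  (0 < mdist x y)%R ->
  powR_potential P 1 b y x <=
  (c * (1 + lC^-1 * cl `^ (lA / al) / (lA / al - 1 - b)) *
    (phi (mdist x y) `^ (b + 1) / V (mdist x y)))%:E.
Proof.
move=> b0 bg r0; have f0 := phi_gt0 r0; have v0 := V_gt0 r0.
have [/andP[C0 C1] _] := V_wlsc; have [cl1 _] := phi_wusc.
have cl0 : (0 < cl)%R by exact: lt_le_trans cl1.
have H1 t := @kernel_profile_le_jump _ _ _ phi_scale V_scale _ _ t x y r0.
have H2 t := @kernel_profile_le_tail _ _ _ _ _ _ _ phi_scale V_scale phi_infty
  lA_gt0 al_gt0 V_wlsc phi_wusc _ _ t x y r0.
set f := phi _ in f0 H1 H2 *; set v := V _ in v0 H1 H2 *.
set g := (lA / al)%R in bg H2 *.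
pose D1 : set R := [set` `]0, f[%R]; pose D2 : set R := [set` `[f, +oo[%R].
pose K1 := (c * f `^ b / v)%R.
pose K2 := (c * ((lC * v)^-1 * (cl * f) `^ g))%R.
have K10 : (0 <= K1)%R by rewrite /K1 !mulr_ge0 ?invr_ge0 ?powR_ge0 ?ltW.
have K20 : (0 <= K2)%R by rewrite /K2 !mulr_ge0 ?invr_ge0 ?powR_ge0 ?mulr_ge0 ?ltW.
have mD1 : measurable D1 by exact: measurable_itv.
have mD2 : measurable D2 by exact: measurable_itv.
(* With this [s] the large-time integrand [t^b * t^(- g)] is [t^(- s - 1)]; the upper bound on [b]
   says exactly that [s > 0]. *)
pose s := (g - 1 - b)%R.
have s0 : (0 < s)%R by rewrite subr_gt0.
have mpow : measurable_fun [set: R] (fun t : R => (t `^ (- s - 1))%:E).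
  by apply/measurable_EFinP; exact: measurable_powR.
have mg2 : measurable_fun [set: R] (fun t : R => K2%:E * (t `^ (- s - 1))%:E).
  exact: measurable_funeM.
have mr1 := (measurable_restrictT (cst K1%:E) mD1).1 (measurable_cst _).
have mr2 := (measurable_restrictT _ mD2).1 (measurable_funTS mg2).
have g10 t : 0 <= ((cst K1%:E) \_ D1) t by apply: erestrict_ge0 => u _; rewrite lee_fin.
have g20 t : 0 <= ((fun t : R => K2%:E * (t `^ (- s - 1))%:E) \_ D2) t.
  by apply: erestrict_ge0 => u _; rewrite mule_ge0// lee_fin ?powR_ge0.
apply: (@le_trans _ _ (\int[mu]_t (((cst K1%:E) \_ D1) t +
    ((fun t => K2%:E * (t `^ (- s - 1))%:E) \_ D2) t))).
  apply: ge0_le_integral => //.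
  - by move=> t _; rewrite mule_ge0// powR_weight_ge0.
  - exact: emeasurable_funD.
  move=> t _; have [t0|t0] := leP t 0%R.
    by rewrite powR_weight_npos// mul0e adde_ge0.
  rewrite !patchE !mem_setE !in_itv/= andbT.
  rewrite /powR_weight t0 mul1r.
  have /andP[_ Pup] := P_approx x y t0.
  have [tf|ft] := ltP t f.
    rewrite /= adde0.
    apply: (@le_trans _ _ ((t `^ b)%:E * (c%:E * (t / (v * f))%:E))).
      apply: lee_wpmul2l; first by rewrite lee_fin powR_ge0.
      apply: (le_trans Pup); apply: lee_wpmul2l; first by rewrite lee_fin ltW.
      exact: H1.
    rewrite -!EFinM lee_fin /K1.
    have -> : (t `^ b * (c * (t / (v * f))) = c * (t `^ b * (t / f)) / v)%R.
      by field; rewrite !gt_eqF.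
    rewrite ler_pM2r ?invr_gt0// ler_pM2l//.
    apply: (@le_trans _ _ (t `^ b)%R).
      by rewrite ger_pMr ?powR_gt0// ler_pdivrMr// mul1r ltW.
    by rewrite ge0_ler_powR ?nnegrE ?ltW.
  rewrite /= add0e.
  apply: (@le_trans _ _ ((t `^ b)%:E * (c%:E * ((lC * v)^-1 * (cl * f) `^ g * t `^ (- g))%:E))).
    apply: lee_wpmul2l; first by rewrite lee_fin powR_ge0.
    apply: (le_trans Pup); apply: lee_wpmul2l; first by rewrite lee_fin ltW.
    exact: H2.
  rewrite -!EFinM lee_fin /K2.
  have -> : (t `^ (- s - 1) = t `^ b * t `^ (- g))%R.
    rewrite -powRD; last by apply/implyP => _; rewrite gt_eqF.
    by congr (_ `^ _)%R; rewrite /s; ring.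
  by rewrite le_eqVlt; apply/orP; left; apply/eqP; ring.
rewrite ge0_integralD//.
have muD1 : mu D1 = f%:E by rewrite lebesgue_measure_itv/= lte_fin f0 sube0.
rewrite -!integral_mkcond integral_cst// [X in _ * X + _]muD1.
have mp : measurable_fun D2 (fun t : R => (t `^ (- s - 1))%:E) by exact: (measurable_funTS mpow).
have p0 t : D2 t -> 0 <= ((t `^ (- s - 1))%R)%:E by rewrite lee_fin powR_ge0.
rewrite (@ge0_integralZl_EFin _ GR R mu D2 mD2 _ p0 mp _ K20).
rewrite /D2 integral_powR_tail// -!EFinM -EFinD lee_fin /K1 /K2.
rewrite powRM ?(ltW cl0) ?(ltW f0)//.
have fb : (f `^ (b + 1) = f `^ b * f)%R.
  by rewrite powRD ?powRr1 ?(ltW f0)//; apply/implyP => _; rewrite gt_eqF.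
have fs : (f `^ g * f `^ (- s) = f `^ b * f)%R.
  rewrite -fb -powRD; last by apply/implyP => _; rewrite gt_eqF.
  by congr (_ `^ _)%R; rewrite /s; ring.
rewrite fb le_eqVlt; apply/orP; left; apply/eqP.
rewrite [LHS](_ : _ = c * f `^ b * f / v +
    c * (lC * v)^-1 * cl `^ g * (f `^ g * f `^ (- s)) / s)%R; last first.
  by field; rewrite !gt_eqF.
rewrite fs /s; field; rewrite !gt_eqF//.
Qed.

End PotentialBounds.

(** * Measurability of radial functions, and points as null sets *)

Section MetricMeasurability.
Context {d : measure_display} {R : realType} {F : measurableMetricType d R}.

Lemma open_metric_ball (y : F) (r : R) : open (ball y r).
Proof.
rewrite openE => z; rewrite ballEmdist/= => yz.
rewrite /interior; apply/nbhs_ballP; exists (r - mdist y z); rewrite /= ?subr_gt0//.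
move=> u; rewrite !ballEmdist/= ltrBrDl; apply: le_lt_trans.
exact: metric_triangle.
Qed.

Hypothesis borelF : borel_sigma_algebra F.

Lemma measurable_metric_ball (y : F) (r : R) : measurable (ball y r).
Proof. by rewrite borelF; apply: sub_sigma_algebra; exact: open_metric_ball. Qed.

Lemma measurable_mdist (y : F) : measurable_fun setT (fun z => mdist z y).
Proof.
apply: (measurability (@RGenInftyO.G R)) => [|/= _ [_] [r] -> <-].
  exact: RGenInftyO.measurableE.
rewrite setTI; have -> : (fun z => mdist z y) @^-1` [set` `]-oo, r[] = ball y r.
  by apply/seteqP; split => z; rewrite ballEmdist/= in_itv/= metric_sym.
exact: measurable_metric_ball.
Qed.

Lemma measurable_scale_function_mdist (f : R -> R) (y : F) : scale_function f ->
  measurable_fun setT (fun z => f (mdist z y)).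
Proof.
move=> [fle _ _].
(* [f] is monotone on nonnegative arguments only; precomposition with [Num.max 0] makes it monotone
   on the whole line without changing it on distances. *)
have -> : (fun z => f (mdist z y)) = (f \o Num.max 0) \o (fun z => mdist z y).
  by apply/funext => z /=; rewrite max_r// mdist_ge0.
apply: measurableT_comp; last exact: measurable_mdist.
apply: nondecreasing_measurable => // r s rs /=.
have m0 (u : R) : Num.max 0 u \in `[0, +oo[ by rewrite in_itv/= andbT le_max lexx.
by apply: fle => //; rewrite ge_max !le_max lexx rs orbT.
Qed.

Lemma measurable_set1_metric (y : F) : measurable [set y].
Proof.
have -> : [set y] = (fun z => mdist z y) @^-1` [set 0].
  apply/seteqP; split => z /= => [->|]; first exact: mdistxx.
  exact: mdist_positivity.
by rewrite -[X in measurable X]setTI; apply: measurable_mdist.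
Qed.

(** Lower scaling from [r] to 1 reads [V r <= r^a * V 1 / k], so small balls around [y] have
    arbitrarily small measure. *)
Lemma measure_set1_eq0 (m : {measure set F -> \bar R}) (V : R -> R) (c2 a k : R) (y : F) :
  scale_function V -> wlsc a k V -> 0 < a -> 0 < c2 ->
  (forall r, 0 <= r -> (m (ball y r) <= (c2 * V r)%:E)%E) -> m [set y] = 0%E.
Proof.
move=> Vs [/andP[k0 k1] hV] a0 c20 vol.
have V1 : 0 < V 1 by case: Vs => _ + _; exact.
apply/eqP; rewrite eq_le measure_ge0 andbT.
apply/lee_addgt0Pr => e e0; rewrite add0e.
(* Chosen so that [c2 * r^a * V 1 / k <= e], and capped at 1 so that the dilation [r^-1] is at least
   1. *)
pose r := Num.min 1 ((e * k / (c2 * V 1)) `^ a^-1).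
have b0 : 0 < e * k / (c2 * V 1) by rewrite !(divr_gt0, mulr_gt0).
have r0 : 0 < r by rewrite lt_min ltr01 powR_gt0.
have r1 : r <= 1 by rewrite ge_min lexx.
have ra : r `^ a <= e * k / (c2 * V 1).
  apply: (@le_trans _ _ (((e * k / (c2 * V 1)) `^ a^-1) `^ a)).
    by rewrite ge0_ler_powR ?nnegrE ?powR_ge0 ?(ltW a0) ?(ltW r0)// ge_min lexx orbT.
  by rewrite -powRrM mulVf ?gt_eqF// powRr1// ltW.
apply: (@le_trans _ _ (m (ball y r))).
  apply: le_measure; rewrite ?inE; [exact: measurable_set1_metric|exact: measurable_metric_ball|].
  by move=> _ ->; rewrite ballEmdist/= mdistxx.
apply: (le_trans (vol _ (ltW r0))); rewrite lee_fin.
have ri1 : 1 <= r^-1 by rewrite invf_ge1.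
have := hV _ _ ri1 r0; rewrite mulVf ?gt_eqF//.
have -> : r^-1 `^ a = (r `^ a)^-1 by rewrite -(powR_inv1 (ltW r0)) -powRrM mulN1r powRN.
have rap : 0 < r `^ a by rewrite powR_gt0.
rewrite -ler_pdivlMl ?mulr_gt0 ?invr_gt0// => Vr.
apply: (@le_trans _ _ (c2 * ((k / r `^ a)^-1 * V 1))); first by rewrite ler_pM2l.
rewrite (_ : c2 * _ = r `^ a * (c2 * V 1) / k); last by field; rewrite !gt_eqF.
by rewrite ler_pdivrMr// -ler_pdivlMr// mulr_gt0.
Qed.

End MetricMeasurability.

(** * Quotients of extended reals *)

Section ErealQuotients.
Context {R : realType}.
Local Open Scope ereal_scope.

Lemma le_inve_fin (h : \bar R) (H : R) : 0 <= h -> h <= H%:E -> (0 < H)%R ->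
  (H^-1)%:E <= h^-1.
Proof.
case: h => [r| |]//; rewrite !lee_fin => r0 rH H0; rewrite inver.
case: ifPn => [_|rn0]; first by rewrite leey.
by rewrite lee_fin lef_pV2 ?posrE// lt_neqAle eq_sym rn0.
Qed.

(** At [h = 0] the product is 0; [h = +oo] is excluded, since the quotient would be 0 while
    [q > 0]. *)
Lemma mule_le_of_le_dive (q h k : \bar R) : 0 < q -> 0 <= h -> 0 <= k ->
  q <= k / h -> q * h <= k.
Proof.
move=> q0 h0 k0; case: h h0 => [r| |]//.
  rewrite lee_fin le_eqVlt => /predU1P[<-|r0]; first by rewrite mule0.
  by rewrite inver gt_eqF// lee_pdivlMr.
by rewrite invey mule0 => _; rewrite leNgt q0.
Qed.

End ErealQuotients.

(** * Cutting the kernel off at nonpositive times *)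

Section PositiveTime.
Context {d : measure_display} {R : realType} {F : measurableMetricType d R}.
Variable m : {measure set F -> \bar R}.
Local Open Scope ereal_scope.
Local Notation mu := (@lebesgue_measure R).
Implicit Type p : R -> F -> F -> \bar R.

(** The values of [p] at nonpositive times are arbitrary; the cutoff makes sign and joint
    measurability hold on the whole line. *)
Definition positive_time p (t : R) (x y : F) : \bar R := if (0 < t)%R then p t x y else 0.

Lemma positive_timeE p t x y : (0 < t)%R -> positive_time p t x y = p t x y.
Proof. by rewrite /positive_time => ->. Qed.

Lemma positive_time_npos p t x y : (t <= 0)%R -> positive_time p t x y = 0.
Proof. by rewrite /positive_time ltNge => ->. Qed.

(** The recursion evaluates the kernel only at [s] and at times within [t - s], all positive, so the
    cutoff is invisible to it. *)
Lemma perturbation_term_positive_time p q n t x z : (0 < t)%R ->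
  perturbation_term m (positive_time p) q n t x z = perturbation_term m p q n t x z.
Proof.
elim: n t x z => [|n IH] t x z t0 /=; first exact: positive_timeE.
apply: eq_integral => s; rewrite inE/= in_itv/= => /andP[s0 st].
apply: eq_integral => w _.
by rewrite positive_timeE// IH// subr_gt0.
Qed.

Lemma schrodinger_positive_time p q t x z : (0 < t)%R ->
  schrodinger_perturbation m (positive_time p) q t x z = schrodinger_perturbation m p q t x z.
Proof.
by move=> t0; apply: eq_eseriesr => n _; exact: perturbation_term_positive_time.
Qed.

Lemma powR_potential_positive_time p c b y x :
  powR_potential (positive_time p) c b y x =
  \int[mu]_(t in `]0%R, +oo[) ((c * t `^ b)%:E * p t x y).
Proof.
rewrite integral_mkcond; apply: eq_integral => t _.
rewrite patchE mem_setE in_itv/= andbT /powR_weight /positive_time.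
by case: ifP => // _; rewrite mul0e.
Qed.

Lemma measurable_positive_time p :
  measurable_fun [set u : R * F * F | (0 < u.1.1)%R]
    (fun u : R * F * F => p u.1.1 u.1.2 u.2) ->
  measurable_fun setT
    (fun u : measurableTypeR R * F * F => positive_time p u.1.1 u.1.2 u.2).
Proof.
move=> mp.
have mD : measurable [set u : R * F * F | (0 < u.1.1)%R].
  rewrite -[X in measurable X]setTI.
  have m11 : measurable_fun setT (fun u : R * F * F => u.1.1).
    exact: (measurableT_comp measurable_fst measurable_fst).
  have -> : [set u : R * F * F | (0 < u.1.1)%R] =
      (fun u : R * F * F => u.1.1) @^-1` [set` `]0%R, +oo[].
    by apply/seteqP; split => u /=; rewrite in_itv/= andbT.
  by apply: m11 => //; exact: measurable_itv.
have := (measurable_restrictT _ mD).1 mp.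
suff -> : (fun u : R * F * F => p u.1.1 u.1.2 u.2) \_ [set u | (0 < u.1.1)%R] =
  (fun u : R * F * F => positive_time p u.1.1 u.1.2 u.2) by [].
apply/funext => u; rewrite patchE /positive_time.
by case: ifPn => [/set_mem/= ->//|]; case: ifP => // u0 /negP; rewrite inE.
Qed.

End PositiveTime.

Theorem mainTheorem13 (R : realType) (d : measure_display)
    (F : measurableMetricType d R)
    (m : {sigma_finite_measure set F -> \bar R})
    (phi V : R -> R) (p : R -> F -> F -> \bar R)
    (c1 c2 lA upalpha lC upc beta : R)
    (borelF : borel_sigma_algebra F)
    (radon_m : radon m)
    (supp_m : full_support m)
    (phi_scale : scale_function phi)
    (V_scale : scale_function V)
    (phi_left : left_continuous phi)
    (phi_infty : phi x @[x --> +oo] --> +oo)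
    (c1_gt0 : 0 < c1) (c2_gt0 : 0 < c2)
    (vol : forall (x : F) (r : R), 0 <= r ->
       ((c1 * V r)%:E <= m (ball x r) <= (c2 * V r)%:E)%E)
    (p_density : symmetric_subprob_density m p)
    (p_approx : exists2 c : R, 0 < c &
       forall (t : R) (x y : F), 0 < t ->
         ((c^-1)%:E * kernel_profile phi V t x y <= p t x y
            <= c%:E * kernel_profile phi V t x y)%E)
    (upalpha_gt0 : 0 < upalpha) (upalpha_lt : upalpha < lA)
    (V_wlsc : wlsc lA lC V)
    (phi_wusc : wusc upalpha upc phi)
    (beta_gt0 : 0 < beta) (beta_lt : beta < lA / upalpha - 1) :
  let hardy_const (C1 : R) := 0 < C1 /\
    forall x y : F, x <> y ->
      (C1%:E / (phi (mdist x y))%:E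
         <= k_function beta p y x / h_function beta p y x)%E in
  let q (C1 : R) (y x : F) := (C1%:E / (phi (mdist x y))%:E)%E in
  let w (y x : F) :=
    ((phi (mdist x y)) `^ (beta + 1) / V (mdist x y))%:E in
  (exists C1 : R, hardy_const C1) /\
  forall C1 : R, hardy_const C1 ->
    exists c : R, forall (x y : F) (t : R), x <> y -> 0 < t ->
      (\int[m]_z (p t x z * w y z) <= c%:E * w y x)%E /\
      (\int[m]_z (schrodinger_perturbation m p (q C1 y) t x z * w y z)
         <= c%:E * w y x)%E.
Proof.
move=> hardy_const q w.
have [V_nd V_gt0 V0] := V_scale; have [phi_nd phi_gt0 phi0] := phi_scale.
have [mp p_ge0 _ p_ck _] := p_density.
have [c c0 pc] := p_approx.
have lA0 : 0 < lA by exact: lt_trans upalpha_lt.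
have bet0 : 0 <= beta by exact: ltW.
pose P := positive_time p.
have mP := measurable_positive_time mp.
have P_ge0 t x y : (0 <= P t x y)%E.
  by rewrite /P /positive_time; case: ifP => // t0; exact: p_ge0.
have P_npos t x y : t <= 0 -> P t x y = 0%E by exact: positive_time_npos.
have P_ck s t x z : 0 < s -> 0 < t ->
    (\int[m]_y (P s x y * P t y z) = P (s + t)%R x z)%E.
  move=> s0 t0; rewrite /P positive_timeE ?addr_gt0// -p_ck//.
  by apply: eq_integral => y _; rewrite !positive_timeE.
have P_approx t x y : 0 < t -> ((c^-1)%:E * kernel_profile phi V t x y <= P t x y
    <= c%:E * kernel_profile phi V t x y)%E.
  by move=> t0; rewrite /P positive_timeE//; exact: pc.
have d_gt0 (x y : F) : x <> y -> 0 < mdist x y by move=> /eqP; rewrite mdist_gt0.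
pose h (y : F) := powR_potential P 1 beta y.
pose k (y : F) := powR_potential P beta (beta - 1) y.
have hE y x : h_function beta p y x = h y x.
  rewrite /h powR_potential_positive_time; apply: eq_integral => t _.
  by rewrite mul1r.
have kE y x : k_function beta p y x = k y x.
  by rewrite /k powR_potential_positive_time.
have h_ge0 y x : (0 <= h y x)%E by exact: powR_potential_ge0.
have k_ge0 y x : (0 <= k y x)%E by exact: powR_potential_ge0.
(* [a1] and [a2] are the constants of [powR_potential_lower] for [h] and [k]; [a3] is that of
   [powR_potential_upper] for [h]. *)
pose a1 := c^-1 * 1 * 2^-1 `^ (beta + 1) * 2^-1.
pose a2 := c^-1 * beta * 2^-1 `^ (beta - 1 + 1) * 2^-1.
pose a3 := c * (1 + lC^-1 * upc `^ (lA / upalpha) / (lA / upalpha - 1 - beta)).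
have half0 : 0 < 2^-1 :> R by rewrite invr_gt0.
have a10 : 0 < a1 by rewrite /a1 mulr1 !mulr_gt0 ?invr_gt0 ?powR_gt0.
have a20 : 0 < a2 by rewrite /a2 !mulr_gt0 ?invr_gt0 ?powR_gt0.
have a30 : 0 < a3.
  have [/andP[C0 _] _] := V_wlsc.
  rewrite /a3 mulr_gt0// addr_gt0// divr_gt0 ?subr_gt0//.
  rewrite mulr_gt0 ?invr_gt0 ?powR_gt0//.
  by have [upc1 _] := phi_wusc; exact: lt_le_trans upc1.
have h_lo x y : x <> y ->
    ((a1 * (phi (mdist x y) `^ (beta + 1) / V (mdist x y)))%:E <= h y x)%E.
  move=> /d_gt0 xy; apply: (powR_potential_lower phi_scale V_scale phi_infty
    mP P_ge0 c0 P_approx ler01 _ xy).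
  by rewrite addr_ge0.
have k_lo x y : x <> y ->
    ((a2 * (phi (mdist x y) `^ (beta - 1 + 1) / V (mdist x y)))%:E <= k y x)%E.
  move=> /d_gt0 xy; apply: (powR_potential_lower phi_scale V_scale phi_infty
    mP P_ge0 c0 P_approx bet0 _ xy).
  by rewrite subrK.
have h_up x y : x <> y ->
    (h y x <= (a3 * (phi (mdist x y) `^ (beta + 1) / V (mdist x y)))%:E)%E.
  move=> /d_gt0 xy.
  exact: (powR_potential_upper phi_scale V_scale phi_infty lA0 upalpha_gt0 V_wlsc
    phi_wusc mP P_ge0 c0 P_approx beta_gt0 beta_lt xy).
split.
  (* Lower bound of [k] over upper bound of [h]: the volumes cancel and [phi^beta / phi^(beta + 1)]
     leaves [phi^-1]. *)
  exists (a2 / a3); split; first exact: divr_gt0.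
  move=> x y xy; have r0 := d_gt0 _ _ xy.
  have f0 := phi_gt0 _ r0; have v0 := V_gt0 _ r0.
  rewrite hE kE inver gt_eqF// -EFinM.
  have ub0 : 0 < a3 * (phi (mdist x y) `^ (beta + 1) / V (mdist x y)).
    by rewrite mulr_gt0// divr_gt0// powR_gt0.
  apply: le_trans (lee_pmul _ _ (k_lo _ _ xy) (le_inve_fin (h_ge0 _ _) (h_up _ _ xy) ub0)).
  - rewrite -EFinM lee_fin subrK.
    have -> : phi (mdist x y) `^ (beta + 1) = phi (mdist x y) `^ beta * phi (mdist x y).
      by rewrite powRD ?powRr1 ?(ltW f0)//; apply/implyP => _; rewrite gt_eqF.
    rewrite le_eqVlt; apply/orP; left; apply/eqP; field.
    by rewrite !gt_eqF// powR_gt0.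
  - rewrite lee_fin; apply: mulr_ge0; first exact: ltW.
    by apply: divr_ge0; [exact: powR_ge0|exact: ltW].
  - by rewrite lee_fin invr_ge0 ltW.
(* The weight is at most [a1^-1 * h], and [h] at most [a3] times the weight; [C1] enters only
   through [q h <= k]. *)
move=> C1 [C10 hC]; exists (a1^-1 * a3) => x y t xy t0.
have f_ge0 z : 0 <= phi (mdist z y) by apply: scale_function_ge0 => //; exact: mdist_ge0.
have v_ge0 z : 0 <= V (mdist z y) by apply: scale_function_ge0 => //; exact: mdist_ge0.
pose wr z := phi (mdist z y) `^ (beta + 1) / V (mdist z y).
have wr0 z : 0 <= wr z by rewrite divr_ge0// powR_ge0.
have mphi := measurable_scale_function_mdist borelF y phi_scale.
have mV := measurable_scale_function_mdist borelF y V_scale.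
have measurable_inv (f : F -> R) : measurable_fun setT f -> (forall z, 0 <= f z) ->
    measurable_fun setT (fun z => (f z)^-1).
  move=> mf f0; under eq_fun do rewrite -powR_inv1//.
  exact: (measurableT_comp (measurable_powR _)).
have mw : measurable_fun setT wr.
  apply: measurable_funM; last exact: measurable_inv.
  exact: (measurableT_comp (measurable_powR _)).
have q_ge0 z : (0 <= q C1 y z)%E.
  by rewrite /q mule_ge0 ?inve_ge0 ?lee_fin ?(ltW C10).
have mq : measurable_fun setT (q C1 y).
  (* The pole of [q], where the extended inverse is [+oo], is separated from the real-valued
     part. *)
  have -> : q C1 y = fun z => if phi (mdist z y) == 0 then +oo%E
      else (C1 * (phi (mdist z y))^-1)%:E.
    apply/funext => z; rewrite /q inver; case: ifP => // _.
    by rewrite gt0_muley// lte_fin.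
  apply: measurable_fun_ifT => //.
  - exact: measurable_fun_eqr.
  - apply/measurable_EFinP/measurable_funM => //; exact: measurable_inv.
have mh : measurable_fun setT (h y) by exact: measurable_powR_potential.
have mk : measurable_fun setT (k y) by exact: measurable_powR_potential.
have my : m [set y] = 0%E.
  apply: (measure_set1_eq0 borelF V_scale V_wlsc lA0 c2_gt0) => r r0.
  by have /andP[] := vol y r r0.
have qhk : {ae m, forall z, (q C1 y z * h y z <= k y z)%E}.
  exists [set y]; split => //; first exact: measurable_set1_metric.
  move=> z /= nz; apply: contrapT => zy; apply: nz.
  have f0 := phi_gt0 _ (d_gt0 _ _ zy).
  apply: mule_le_of_le_dive => //; last by rewrite -hE -kE; exact: hC.
  by rewrite /q inver gt_eqF// -EFinM lte_fin divr_gt0.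
have super s z : 0 < s -> (\int[m]_u (P s z u * h y u) +
    \int[lebesgue_measure]_(r in `]0%R, s[) \int[m]_v (P r z v * q C1 y v * h y v) <= h y z)%E.
  move=> s0; apply: (perturbed_excess mP P_ge0 mq q_ge0 mh (h_ge0 y) mk (k_ge0 y) qhk).
  exact: (powR_potential_excess mP P_ge0 P_npos P_ck z y beta_gt0 s0).
have wh z : ((wr z)%:E <= (a1^-1)%:E * h y z)%E.
  have [->|/eqP zy] := eqVneq z y.
    rewrite /wr mdistxx phi0 powR0 ?mul0r ?gt_eqF ?addr_gt0//.
    by rewrite mule_ge0 ?lee_fin ?invr_ge0 ?(ltW a10).
  apply: le_trans (lee_wpmul2l _ (h_lo _ _ zy)); last by rewrite lee_fin invr_ge0 ltW.
  by rewrite -EFinM lee_fin mulrA mulVf ?gt_eqF// mul1r.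
have ai0 : 0 <= a1^-1 by rewrite invr_ge0 ltW.
have [I1 I2] := integral_schrodinger_perturbation_le mP P_ge0 P_npos
  mq q_ge0 mh (h_ge0 y) super x mw wr0 ai0 wh t0.
have fin : ((a1^-1)%:E * h y x <= (a1^-1 * a3)%:E * w y x)%E.
  rewrite EFinM -muleA; apply: lee_wpmul2l; first by rewrite lee_fin.
  by apply: le_trans (h_up _ _ xy) _; rewrite EFinM.
split.
  apply: le_trans fin; apply: le_trans I1.
  rewrite le_eqVlt; apply/orP; left; apply/eqP; apply: eq_integral => z _.
  by rewrite /P positive_timeE.
apply: le_trans fin; apply: le_trans I2.
rewrite le_eqVlt; apply/orP; left; apply/eqP; apply: eq_integral => z _.
by rewrite /P schrodinger_positive_time.
Qed.
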